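(* The competitive ratio for Non-monotone Secretary is at most $n$ and at least $\Omega(n/\log^* n)$. This holds both in the model where the online algorithm knows the entire set system in advance (but not the values) and in the model where the algorithm has oracle access to queries of the form ''is $S$ a subset of a feasible set?''.
   Context: Non-monotone Secretary: there are $n$ items with adversarially chosen non-negative values and an arbitrary (not necessarily downward-closed) family $\mathcal{F}$ of feasible subsets of the items. Items arrive in a uniformly random order; upon arrival of an item the algorithm observes its value and decides immediately and irrevocably whether to select it; the final selected set must belong to $\mathcal{F}$. The algorithm either knows $\mathcal{F}$ in advance, or has an oracle answering whether a given set $S$ is a subset of a feasible set. The competitive ratio is the worst case over instances of $\max_{S\in\mathcal{F}}\sum_{i\in S}y_i$ divided by the algorithm's expected value. $\log^*$ denotes the iterated logarithm. *)

(* Defs.v *)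
From HB Require Import structures.
From mathcomp Require Import all_boot all_order all_algebra all_fingroup.
From mathcomp Require Import all_classical all_reals all_analysis.
From mathcomp Require Import lra.

Set Implicit Arguments.
Unset Strict Implicit.
Unset Printing Implicit Defensive.

Import Order.TTheory GRing.Theory Num.Theory.
Local Open Scope ring_scope.

Definition log2 {R : realType} (x : R) : R := ln x / ln 2.

Lemma iter_log2_le1 {R : realType} (x : R) : exists k, iter k log2 x <= 1.
Proof.
have ln2 : 2^-1 <= ln 2 :> R.
  have := @le_ln1Dx R (- 2^-1).
  rewrite (_ : 1 + - 2^-1 = 2^-1 :> R); last by lra.
  by rewrite lnV ?posrE// => /(_ ltac:(lra)); lra.
have ln2_gt0 : 0 < ln 2 :> R by lra.
have ln2N : ln 2 != 0 :> R by rewrite gt_eqF.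
have log2_small (y : R) : y <= 2 -> log2 y <= 1.
  move=> y2; rewrite /log2 ler_pdivrMr// mul1r.
  by have [y0|y0] := leP y 0; [rewrite ln0// ltW | rewrite ler_ln ?posrE].
have log2_sub1 (y : R) : 2 < y -> log2 y <= y - 1.
  move=> y2; rewrite /log2 ler_pdivrMr//.
  have := @le_ln1Dx R (y / 2 - 1); rewrite (_ : 1 + (y / 2 - 1) = y / 2); last by lra.
  rewrite ln_div ?posrE//; last by lra.
  by move=> /(_ ltac:(lra)); nra.
suff [n] : exists n : nat, x <= n.+1%:R.
  elim: n x => [|n IHn] x xn; first by exists 0%N.
  have [x2|x2] := leP x 2; first by exists 1%N; exact: log2_small.
  have [|k k1] := IHn (log2 x); last by exists k.+1; rewrite iterSr.
  apply: le_trans (log2_sub1 _ x2) _.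
  by rewrite lerBlDr (le_trans xn)// -[in leLHS]natr1.
exists (Num.truncn `|x|); apply: le_trans (ler_norm x) _.
by rewrite ltW// truncnS_gt.
Qed.

(* the least k such that the k-th iterate of log2 takes x to a value <= 1 *)
Definition log_star {R : realType} (x : R) : nat := ex_minn (iter_log2_le1 x).

Section NonMonotoneSecretary.
Context {R : realType} {n : nat}.

Definition feasible_family := {set {set 'I_n}}.

(* [F] is an arbitrary nonempty family: it is assumed neither downward closed
   nor covering all the items. *)
Definition is_instance (F : feasible_family) (y : 'I_n -> R) : Prop :=
  F != finset.set0 /\ forall i, 0 <= y i.

Definition opt (F : feasible_family) (y : 'I_n -> R) : R :=
  \big[Num.max/0]_(S in F) \sum_(i in S) y i.

(* A deterministic online rule: given the items arrived so far with their
   values, the current item being the last one, say whether to select it.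
   The earlier decisions need not be recorded, as they are determined by the
   rule and the history. *)
Definition policy := seq ('I_n * R) -> bool.

(* [s t] is the item arriving at time [t] *)
Definition history (y : 'I_n -> R) (s : 'S_n) (t : 'I_n) : seq ('I_n * R) :=
  [seq (s u, y (s u)) | u : 'I_n <- enum 'I_n & (u <= t)%N].

Definition selected (a : policy) (y : 'I_n -> R) (s : 'S_n) : {set 'I_n} :=
  [set s t | t : 'I_n & a (history y s t)].

(* A randomized algorithm, with random seed in [T], that knows the family. *)
Definition algorithm (T : Type) := T -> feasible_family -> policy.

Definition valid_algorithm d (T : measurableType d) (A : algorithm T) : Prop :=
  (forall (F : feasible_family) h, measurable [set w | A w F h]%classic) /\
  (forall w F y s, is_instance F y -> selected (A w F) y s \in F).

(* the average over a uniformly random arrival order *)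
Definition mean_value (a : policy) (y : 'I_n -> R) : R :=
  (\sum_(s : 'S_n) \sum_(i in selected a y s) y i) / n`!%:R.

(* The seed is independent of the arrival order. *)
Definition expected_value d (T : measurableType d) (P : probability T R)
    (A : algorithm T) (F : feasible_family) (y : 'I_n -> R) : \bar R :=
  ('E_P[fun w => mean_value (A w F) y])%E.

(* In \bar R one has 0^-1 = +oo and 0 * +oo = 0: an instance on which the
   algorithm gets 0 contributes +oo if its optimum is positive, and 0 if its
   optimum is 0. *)
Definition algorithm_ratio d (T : measurableType d) (P : probability T R)
    (A : algorithm T) : \bar R :=
  ereal_sup [set r | exists F y, is_instance F y /\
                     r = ((opt F y)%:E / expected_value P A F y)%E]%classic.

(* Finite adaptive interaction with a membership oracle, ending in a decision. *)
Inductive oracle_program :=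
  | Decide of bool
  | Query of {set 'I_n} & (bool -> oracle_program).

Fixpoint run (O : {set 'I_n} -> bool) (p : oracle_program) : bool :=
  match p with
  | Decide b => b
  | Query X k => run O (k (O X))
  end.

Definition extendable (F : feasible_family) (S : {set 'I_n}) : bool :=
  [exists X in F, S \subset X].

(* A randomized algorithm that reaches the set system only through the oracle.
   The answers to queries made at earlier arrivals need not be recorded:
   they can be asked for again. *)
Definition oracle_algorithm (T : Type) := T -> seq ('I_n * R) -> oracle_program.

Definition with_oracle T (B : oracle_algorithm T) : algorithm T :=
  fun w F h => run (extendable F) (B w h).

End NonMonotoneSecretary.

Arguments feasible_family : clear implicits.
Arguments policy : clear implicits.
Arguments algorithm : clear implicits.
Arguments oracle_program : clear implicits.
Arguments oracle_algorithm : clear implicits.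

Definition competitive_ratio_known (R : realType) (n : nat) : \bar R :=
  ereal_inf [set r | exists (d : measure_display) (T : measurableType d)
                            (P : probability T R) (A : algorithm R n T),
                       valid_algorithm A /\ r = algorithm_ratio P A]%classic.

Definition competitive_ratio_oracle (R : realType) (n : nat) : \bar R :=
  ereal_inf [set r | exists (d : measure_display) (T : measurableType d)
                            (P : probability T R) (B : oracle_algorithm R n T),
                       valid_algorithm (with_oracle B) /\
                       r = algorithm_ratio P (with_oracle B)]%classic.

(* f n = Omega (n / log* n) *)
Definition Omega_n_div_log_star {R : realType} (f : nat -> \bar R) : Prop :=
  exists (c : R) (n0 : nat), 0 < c /\
    forall n, (n0 <= n)%N ->
      ((c * (n%:R / (log_star (n%:R : R))%:R))%:E <= f n)%E.

(* Main.v *)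
Require Import Defs.
From mathcomp Require Import all_boot all_order all_algebra all_fingroup.
From mathcomp Require Import all_classical all_reals all_analysis.
From mathcomp Require Import measurable_realfun ring lra zify.

(* Upper bound: let [i] be the first item to arrive, and select a maximal
   extendable set containing [i] if there is one; it is feasible, and [i] is
   uniform, so the expected value is at least the average of the values of the
   items that lie in some feasible set.

   Lower bound: the ratio is in fact of order [n].  Take at least [n / 4] goods
   [x], each lying in a single feasible set [S x], such that any two of these
   sets differ on at least [n / 8] items, and give value 1 to one uniformly
   random good.  To win, a policy must decide compatibly with [S x] until [x]
   arrives, while seeing only zeros: [x] must be live on arrival.  Two goods
   that are both live after [t] arrivals are not separated by any of these [t]
   items, which has probability at most [(7/8) ^ t]; by Cauchy-Schwarz the
   expected number of live goods, when there are at least two, decays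
   geometrically.  Once at most one good is live, at most one more can be live
   on arrival, so the expected number of goods live on arrival is bounded. *)

Set Implicit Arguments.
Unset Strict Implicit.
Unset Printing Implicit Defensive.

Import fintype finset.
Import Order.TTheory GRing.Theory Num.Theory.
Local Open Scope ring_scope.

(** * Random arrival orders: exchange and avoidance *)

Section Swap.
Variable n : nat.
Implicit Types (s : 'S_n) (t u v : 'I_n).

(* Swapping the arrivals at times [t] and [v] preserves the past of [t], so the
   item at time [t] is equidistributed with the item at any later time. *)
Lemma card_perm_hit (W : 'S_n -> {set 'I_n}) t :
  (forall s v, (t <= v)%N -> W (tperm t v * s)%g = W s) ->
  ((n - t) * #|[set s : 'S_n | s t \in W s]| =
   \sum_(s : 'S_n) #|[set v : 'I_n | (t <= v)%N & s v \in W s]|)%N.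
Proof.
move=> HW.
have E v : (t <= v)%N ->
    (\sum_(s : 'S_n) (s v \in W s) = #|[set s : 'S_n | s t \in W s]|)%N.
  move=> tv; rewrite -sum1_card [RHS]big_mkcond/= [RHS](reindex_inj (mulgI (tperm t v))).
  apply: eq_bigr => s _; rewrite inE HW// permM tpermL.
  by case: (_ \in _).
under eq_bigr do rewrite -sum1_card big_mkcond/=.
rewrite exchange_big/=.
rewrite (eq_bigr (fun v => if (t <= v)%N then
   #|[set s : 'S_n | s t \in W s]| else 0%N)); last first.
  move=> v _; case: ifP => tv; last by rewrite big1// => s _; rewrite inE tv.
  by rewrite -(E v tv); apply: eq_bigr => s _; rewrite inE tv/=; case: (_ \in _).
rewrite -big_mkcond/= sum_nat_const; congr (_ * _)%N.
have := cardC [pred v : 'I_n | (v < t)%N].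
rewrite card_ord.
have -> : #|[pred v : 'I_n | (v < t)%N]| = t.
  have -> : #|[pred v : 'I_n | (v < t)%N]| = #|[set widen_ord (ltnW (ltn_ord t)) i | i : 'I_t]|.
    apply: eq_card => v; rewrite !inE; apply/idP/imsetP => [vt|[i _ ->]//=].
    by exists (Ordinal vt) => //; apply: val_inj.
  by rewrite card_imset ?card_ord// => i j /(congr1 val)/= /val_inj.
move/(congr1 (subn^~ t)); rewrite addKn => <-; apply: eq_card => v.
by rewrite !inE -leqNgt.
Qed.

(** Induction on [k]: while [D] is untouched, all of it lies among the [n - k] remaining items, so
    the next item falls in [D] with probability at least [#|D| / n]. *)
Lemma card_perm_avoid (R : realType) (D : {set 'I_n}) k : (k <= n)%N ->
  #|[set s : 'S_n | [forall u : 'I_n, (u < k)%N ==> (s u \notin D)]]|%:R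
  <= n`!%:R * (1 - #|D|%:R / n%:R) ^+ k :> R.
Proof.
pose X k := [set s : 'S_n | [forall u : 'I_n, (u < k)%N ==> (s u \notin D)]].
suff: (k <= n)%N -> #|X k|%:R <= n`!%:R * (1 - #|D|%:R / n%:R) ^+ k :> R by [].
elim: k => [_|k IH kn].
  by rewrite expr0 mulr1 ler_nat -card_Sn max_card.
have {IH} := IH (ltnW kn).
set t := Ordinal kn.
pose W s : {set 'I_n} := if s \in X k then D else finset.set0.
have HW s v : (t <= v)%N -> W (tperm t v * s)%g = W s.
  move=> tv; rewrite /W; congr (if _ then _ else _).
  rewrite !inE; apply: eq_forallb => u; case: ltnP => //= uk.
  by rewrite permM tpermD// -val_eqE/= gtn_eqF// (leq_trans uk).
have := card_perm_hit HW.
(* If the first [k] items avoid [D], every item of [D] arrives at time [t] or later. *)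
have -> : (\sum_(s : 'S_n) #|[set v : 'I_n | (t <= v)%N & s v \in W s]| = #|X k| * #|D|)%N.
  rewrite -sum_nat_const [RHS]big_mkcond/=; apply: eq_bigr => s _.
  rewrite /W; case: ifP => sX; last first.
    by apply: eq_card0 => v; rewrite !inE andbF.
  rewrite -(card_imset _ (@perm_inj _ s)); apply: eq_card => x.
  apply/imsetP/idP => [[v]|xD]; first by rewrite inE => /andP[_ +] ->.
  exists (s^-1 x)%g; last by rewrite permKV.
  rewrite inE permKV xD andbT leqNgt; apply/negP => vk.
  move: sX; rewrite inE => /forallP/(_ (s^-1 x)%g); rewrite vk/= permKV xD.
  by [].
have sub : X k.+1 \subset X k.
  apply/subsetP => s; rewrite !inE => /forallP H; apply/forallP => u.
  by apply/implyP => uk; move: (H u); rewrite ltnS ltnW.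
have -> : #|[set s : 'S_n | s t \in W s]| = (#|X k| - #|X k.+1|)%N.
  have -> : [set s : 'S_n | s t \in W s] = X k :\: X k.+1.
    apply/setP => s; rewrite finset.in_setD [in LHS]inE /W.
    case: (boolP (s \in X k)) => sX; last by rewrite andbF inE.
    rewrite andbT [in RHS]inE; apply/idP/idP => [stD|].
      by apply/negP => /forallP/(_ t); rewrite ltnSn/= stD.
    apply: contraNT => stD; apply/forallP => u; apply/implyP.
    rewrite ltnS leq_eqVlt => /orP[/eqP ut|uk].
      by rewrite (_ : u = t)//; apply: val_inj.
    by move: sX; rewrite inE => /forallP/(_ u); rewrite uk.
  by rewrite cardsD (finset.setIidPr sub).
have le1 := subset_leq_card sub.
move/(congr1 (fun k => k%:R : R)).
rewrite !natrM (natrB _ (ltnW kn)) (natrB _ le1).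
have k_ge0 : 0 <= k%:R :> R by [].
have kn' : k%:R + 1 <= n%:R :> R by rewrite natr1 ler_nat.
have : #|X k.+1|%:R <= #|X k|%:R :> R by rewrite ler_nat.
have : #|D|%:R <= n%:R :> R by rewrite ler_nat -[X in (_ <= X)%N]card_ord max_card.
set x := #|X k|%:R; set x' := #|X k.+1|%:R; set d := #|D|%:R; set N := n%:R.
move=> dN xx E IH.
rewrite exprSr mulrA.
have N0 : 0 < N by rewrite /N; lra.
have q0 : 0 <= 1 - d / N by rewrite subr_ge0 ler_pdivrMr// mul1r.
apply: le_trans (ler_wpM2r q0 IH).
rewrite -/x.
have : x * d <= N * (x - x') by rewrite -E ler_wpM2r ?subr_ge0// /N; lra.
move=> H; rewrite mulrBr mulr1 mulrA lerBrDr -lerBrDl ler_pdivrMr//.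
by rewrite mulrC [X in _ <= X]mulrC; lra.
Qed.

End Swap.

(** * A family of pairwise well-separated sets *)

Definition separators n (X Y : {set 'I_n}) : {set 'I_n} :=
  [set z | (z \in X) != (z \in Y)].

(** Toggling in [C] a point on which [A] and [B] differ changes exactly one of the two parities;
    this involution exchanges the counted sets with the others. *)
Lemma card_odd_setI (I : finType) (A B : {set I}) : A != B ->
  (2 * #|[set C : {set I} | odd #|A :&: C| != odd #|B :&: C|]| = 2 ^ #|I|)%N.
Proof.
move=> AB.
have [x xAB] : exists x, (x \in A) != (x \in B).
  apply/existsP; apply: contraNT AB; rewrite negb_exists => /forallP H.
  by apply/eqP/setP => x; apply/eqP; rewrite -[_ == _]negbK.
pose f (C : {set I}) := if x \in C then C :\ x else x |: C.
have fx C y : (y \in f C) = (y \in C) (+) (y == x).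
  rewrite /f; case: ifP => xC; rewrite !inE; case: eqP => [->|_] /=; rewrite ?xC ?addbF//.
have fK : involutive f by move=> C; apply/setP => y; rewrite !fx -addbA addbb addbF.
have oddf D C : odd #|D :&: f C| = odd #|D :&: C| (+) (x \in D).
  rewrite (cardsD1 x (D :&: f C)) (cardsD1 x (D :&: C)) !oddD !inE fx eqxx addbT.
  have -> : (D :&: f C) :\ x = (D :&: C) :\ x.
    by apply/setP => y; rewrite !inE fx; case: eqP; rewrite ?addbF.
  by case: (x \in D); case: (x \in C) => /=; case: (odd #|_|).
set P := [set C | _].
have -> : (2 ^ #|I| = #|[set: {set I}]|)%N.
  by rewrite -powersetT card_powerset cardsT.
rewrite cardsT -(cardsC P) mul2n -addnn; congr addn.
rewrite -(card_imset _ (inv_inj fK)); apply: eq_card => C.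
rewrite -[C in LHS]fK mem_imset; last exact: inv_inj.
rewrite !inE !oddf.
by case: odd; case: odd; case: (x \in A) xAB; case: (x \in B).
Qed.

Lemma dyadic_bounds n : (2 <= n)%N -> exists m, (2 ^ m.+1 <= n < 2 ^ m.+2)%N.
Proof.
move=> n2; exists (trunc_log 2 n).-1.
have : (0 < trunc_log 2 n)%N by rewrite trunc_log_gt0.
case E : (trunc_log 2 n) => [//|k] _ /=; rewrite -E.
by rewrite trunc_logP ?trunc_log_ltn// (leq_trans _ n2).
Qed.

(* The items are two copies of [F_2 ^ m], a pair [(g, c)] being related by
   the value of their inner product. *)
Lemma separated_family n : (2 <= n)%N ->
  exists (G : {set 'I_n}) (S : 'I_n -> {set 'I_n}),
  [/\ (2 * #|G| <= n)%N, (n <= 4 * #|G|)%N,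
      forall x y, x \in G -> y \in G -> (y \in S x) = (y == x) &
      forall x y, x \in G -> y \in G -> x != y ->
        (n <= 8 * #|separators (S x) (S y)|)%N].
Proof.
move=> n2; have [m /andP[lo hi]] := dyadic_bounds n2.
have cardV : #|{set 'I_m}| = (2 ^ m)%N.
  by rewrite -cardsT -powersetT card_powerset cardsT card_ord.
have cardVV : #|{: {set 'I_m} + {set 'I_m}}| = (2 ^ m.+1)%N.
  by rewrite card_sum cardV expnS mul2n addnn.
have le : (#|{: {set 'I_m} + {set 'I_m}}| <= n)%N by rewrite cardVV.
pose e (v : {set 'I_m} + {set 'I_m}) : 'I_n := widen_ord le (enum_rank v).
have e_inj : injective e by move=> u v /(congr1 val)/= /val_inj/enum_rank_inj.
pose S (A : {set 'I_m}) : {set 'I_n} :=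
  e (inl A) |: [set e (inr C) | C : {set 'I_m} & odd #|A :&: C|].
pose G := [set e (inl A) | A : {set 'I_m}].
have inlS A B : (e (inl B) \in S A) = (A == B).
  rewrite !inE (inj_eq e_inj) [in RHS]eq_sym; case: eqP => [[->]|]; first by rewrite eqxx.
  move=> ne; apply/imsetP/eqP => [[C _ /e_inj//]|AB]; by case: ne; rewrite AB.
have inrS A C : (e (inr C) \in S A) = odd #|A :&: C|.
  rewrite !inE (inj_eq e_inj)/=; apply/imsetP/idP => [[D + /e_inj[->]]|oC].
    by rewrite inE.
  by exists C; rewrite ?inE.
pose T x := if [pick A | x == e (inl A)] is Some A then S A else finset.set0.
have TE A : T (e (inl A)) = S A.
  rewrite /T; case: pickP => [B /eqP/e_inj[->]//|/(_ A)]; by rewrite eqxx.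
have cardG : #|G| = (2 ^ m)%N.
  by rewrite card_imset ?cardV// => A B /e_inj [].
exists G, T; split.
- by rewrite cardG -expnS.
- by rewrite cardG (leq_trans (ltnW hi))// -(expnD 2 2).
- move=> _ _ /imsetP[A _ ->] /imsetP[B _ ->].
  by rewrite TE inlS (inj_eq e_inj) eq_sym.
- move=> _ _ /imsetP[A _ ->] /imsetP[B _ ->]; rewrite (inj_eq e_inj) !TE => AB.
  have {}AB : A != B by apply: contraNneq AB => ->.
  have Hc := card_odd_setI AB.
  (* Half of the [2 ^ m] sets [C] yield separators [e (inr C)]; eight times their number is
     [4 * 2 ^ m], which exceeds [n]. *)
  have : (#|[set C : {set 'I_m} | odd #|A :&: C| != odd #|B :&: C|]| <=
          #|separators (S A) (S B)|)%N.
    rewrite -(@card_imset _ _ (e \o inr)); last by move=> ? ? /e_inj [].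
    apply: subset_leq_card; apply/subsetP => _ /imsetP[C + ->].
    by rewrite !inE -!in_setU1 !inrS.
  move: Hc; rewrite card_ord; move: hi; rewrite !expnS.
  by move: (2 ^ m)%N #|_| #|separators _ _| => *; lia.
Qed.

(** * Geometric decay of the live goods *)

Lemma sum_natr_geometric_le (R : realType) k :
  \sum_(t < k) (t%:R + 1) * (15 / 16) ^+ t <= 256 :> R.
Proof.
(* Closed form, by induction on [k]; the limit is [256 = (1 - 15 / 16) ^- 2]. *)
suff -> : \sum_(t < k) (t%:R + 1) * (15 / 16) ^+ t
    = 256 - (16 * k%:R + 256) * (15 / 16) ^+ k :> R.
  by rewrite lerBlDr lerDl mulr_ge0// ?exprn_ge0//; have : 0 <= k%:R :> R by []; lra.
elim: k => [|k IH]; first by rewrite big_ord0 expr0; lra.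
by rewrite big_ord_recr/= IH exprSr -natr1; field.
Qed.

Section Live.
Variables (R : realType) (n : nat) (G : {set 'I_n}) (S : 'I_n -> {set 'I_n}).
Implicit Types (s : 'S_n) (t u v : 'I_n).
Variable decision : 'S_n -> 'I_n -> bool.
Hypothesis decision_past : forall (s s' : 'S_n) (t : 'I_n),
  (forall u : 'I_n, (u <= t)%N -> s u = s' u) -> decision s t = decision s' t.

(* The goods [x] for which the decisions taken before time [t] are still
   compatible with ending up with the set [S x]. *)
Definition live (s : 'S_n) (t : 'I_n) : {set 'I_n} :=
  [set x in G | [forall u : 'I_n, (u < t)%N ==> ((s u \in S x) == decision s u)]].

Lemma live_anti (s : 'S_n) (t t' : 'I_n) : (t <= t')%N -> live s t' \subset live s t.
Proof.
move=> tt'; apply/subsetP => x; rewrite !inE => /andP[-> /forallP H] /=.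
apply/forallP => u; apply/implyP => ut; have := H u.
by rewrite (leq_trans ut).
Qed.

(** Only decisions at times [u < t] matter, and each depends on arrivals up to [u]; so exchanging
    [t] with a later time leaves [live s t] unchanged. *)
Lemma live_past (s s' : 'S_n) (t : 'I_n) :
  (forall u : 'I_n, (u < t)%N -> s u = s' u) -> live s t = live s' t.
Proof.
move=> H; apply/setP => x; rewrite !inE; congr (_ && _).
apply: eq_forallb => u; case: ltnP => //= ut.
rewrite H// (@decision_past s s')// => v vu.
by rewrite H// (leq_ltn_trans vu).
Qed.

(** Among the times with at most one live good, at most one is a hit: since live sets shrink, the
    goods hit at two such times both lie in the earlier live set, hence coincide. *)
Lemma card_hit_le s :
  (#|[set t | s t \in live s t]| <=
   1 + \sum_(t < n) (1 < #|live s t|)%N * (s t \in live s t))%N.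
Proof.
rewrite -(cardsID [set t | (1 < #|live s t|)%N]) addnC leq_add//.
  apply/card_le1_eqP => t t'.
  wlog tt' : t t' / (t <= t')%N.
    move=> hw tl t'l; case/orP: (leq_total t t') => [tt'|t't]; first exact: hw.
    by apply/esym/hw.
  rewrite !finset.in_setD (finset.in_set (fun t => (1 < #|live s t|)%N)) -leqNgt.
  rewrite !(finset.in_set (fun t => s t \in live s t)) => /andP[l1 tl] /andP[_ t'l].
  have {}t'l := subsetP (live_anti s tt') _ t'l.
  by apply: (@perm_inj _ s); move/card_le1_eqP: l1; apply.
rewrite -sum1_card big_mkcond/=; apply: leq_sum => t _.
rewrite finset.in_setI (finset.in_set (fun t => (1 < #|live s t|)%N)).
rewrite (finset.in_set (fun t => s t \in live s t)).
by case: (_ \in _); case: (_ < _)%N.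
Qed.

Definition large_live s t := if (1 < #|live s t|)%N then live s t else finset.set0.

Hypothesis n_gt0 : (0 < n)%N.
Hypothesis G_le : (2 * #|G| <= n)%N.
Hypothesis sep : forall x y, x \in G -> y \in G -> x != y ->
        (n <= 8 * #|separators (S x) (S y)|)%N.

(* Two goods live at [t] agree with the same decisions, so none of the items
   that separate them has arrived: the choices of the policy are irrelevant. *)
Lemma sum_live_pairs_le t :
  \sum_(s : 'S_n) #|live s t|%:R * (#|live s t|%:R - 1)
  <= #|G|%:R ^+ 2 * (n`!%:R * ((15 / 16) ^+ t) ^+ 2) :> R.
Proof.
have E s : #|live s t|%:R * (#|live s t|%:R - 1) =
   \sum_(p in finset.setX G G)
     ((p.1 != p.2) && (p.1 \in live s t) && (p.2 \in live s t))%:R :> R.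
  transitivity (\sum_(x in live s t) \sum_(y in live s t | y != x) 1 : R).
    have F x : x \in live s t ->
        \sum_(y in live s t | y != x) 1 = #|live s t|%:R - 1 :> R.
      by move=> xl; rewrite -sumr_const (bigD1 x xl)/= addrC addrK.
    by rewrite (eq_bigr _ F) sumr_const mulr_natl.
  rewrite pair_big_dep/= big_mkcond [RHS]big_mkcond/=; apply: eq_bigr => -[x y] _ /=.
  rewrite !inE/= eq_sym; case: (x \in G) => //=; case: (y \in G) => //=; rewrite ?andbF//.
  by case: eqP; case: forallP; case: forallP.
under eq_bigr do rewrite E.
rewrite exchange_big/=.
have -> : #|G|%:R ^+ 2 * (n`!%:R * ((15 / 16) ^+ t) ^+ 2) =
  \sum_(p in finset.setX G G) (n`!%:R * ((15 / 16) ^+ t) ^+ 2) :> R.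
  by rewrite sumr_const finset.cardsX -[RHS]mulr_natl natrM expr2.
apply: ler_sum => -[x y]; rewrite inE/= => /andP[xG yG].
have [->|xy] := eqVneq x y.
  by rewrite big1 ?mulr_ge0// ?exprn_ge0// ?exprn_ge0.
set D := separators (S x) (S y).
have tn := ltnW (ltn_ord t).
apply: le_trans (le_trans (card_perm_avoid R D tn) _).
  rewrite -natr_sum ler_nat -sum1_card [X in (_ <= X)%N]big_mkcond/=.
  apply: leq_sum => s _; rewrite !inE xG yG/=.
  case: forallP => //= Hx; case: forallP => //= Hy.
  suff -> : [forall u : 'I_n, (u < t)%N ==> (s u \notin D)] by [].
  apply/forallP => u; apply/implyP => ut.
  by have := Hx u; have := Hy u; rewrite ut/= inE => /eqP -> /eqP ->; rewrite eqxx.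
(* The rate [7 / 8 = 224 / 256] is rounded up to the square [(15 / 16) ^ 2], whose root serves in
   the AM-GM bound. *)
rewrite ler_wpM2l// exprAC lerXn2r ?nnegrE//.
- rewrite subr_ge0 ler_pdivrMr ?ltr0n// mul1r ler_nat.
  by rewrite -[X in (_ <= X)%N]card_ord max_card.
have : n%:R <= 8 * #|D|%:R :> R by rewrite -natrM ler_nat sep.
have n0 : 0 < n%:R :> R by rewrite ltr0n.
move=> nD; rewrite lerBlDr -lerBlDl ler_pdivlMr//; lra.
Qed.

(** From pairs to single goods, with AM-GM in place of Cauchy-Schwarz; [3 / 2] is [1 / 2] from the
    constant term [a / 2] plus [1] from the pairs. *)
Lemma sum_large_live_le t :
  \sum_(s : 'S_n) #|large_live s t|%:R
  <= 3 / 2 * #|G|%:R * (15 / 16) ^+ t * n`!%:R :> R.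
Proof.
have [G0|G0] := posnP #|G|.
  rewrite G0 mulr0 !mul0r big1// => s _.
  have -> : large_live s t = finset.set0; last by rewrite cards0.
  apply/eqP; rewrite -finset.subset0 -(cards0_eq G0) /large_live; case: ifP => _; last exact: finset.sub0set.
  by apply/subsetP => x; rewrite inE => /andP[].
pose a : R := #|G|%:R * (15 / 16) ^+ t.
have a0 : 0 < a by rewrite mulr_gt0 ?ltr0n ?exprn_gt0.
have bound s : #|large_live s t|%:R
    <= a / 2 + #|live s t|%:R * (#|live s t|%:R - 1) / a :> R.
  rewrite /large_live; case: ifP => l1; last first.
    rewrite cards0 addr_ge0 ?divr_ge0 ?(ltW a0)//.
    by move: #|_| => -[|k]; rewrite ?mul0r// mulr_ge0// subr_ge0 ler1n.
  have : 2 <= #|live s t|%:R :> R by rewrite ler_nat.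
  move: #|live s t|%:R => l l2.
  rewrite -(ler_pM2r a0) mulrDl divfK ?gt_eqF//.
  (* AM-GM: [l <= a / 2 + l ^ 2 / (2 * a)], and [l ^ 2 <= 2 * l * (l - 1)] *)
  have := sqr_ge0 (l - a); nra.
apply: le_trans (ler_sum _ (fun s _ => bound s)) _.
rewrite big_split/= sumr_const card_Sn -mulr_suml.
have := sum_live_pairs_le t.
rewrite -/a -lerBrDl => H.
rewrite ler_pdivrMr//; apply: le_trans H _.
rewrite [X in _ <= (X - _) * _](_ : _ = 3 / 2 * a * n`!%:R); last by rewrite /a; ring.
rewrite -mulr_natr.
by rewrite /a exprMn; lra.
Qed.

(* [193 = 1 + 3 / 4 * 256] *)
Lemma sum_card_hit_le :
  \sum_(s : 'S_n) #|[set t | s t \in live s t]|%:R <= 193 * n`!%:R :> R.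
Proof.
have h1 s : #|[set t | s t \in live s t]|%:R <=
    1 + \sum_(t < n) (s t \in large_live s t)%:R :> R.
  apply: le_trans (_ : (1 + \sum_(t < n) (1 < #|live s t|)%N * (s t \in live s t))%:R <= _).
    by rewrite ler_nat card_hit_le.
  rewrite natrD natr_sum lerD2l ler_sum// => t _.
  by rewrite /large_live; case: ltnP; rewrite ?inE ?mul1n.
apply: le_trans (ler_sum _ (fun s _ => h1 s)) _.
rewrite big_split/= sumr_const card_Sn exchange_big/=.
have h2 t : \sum_(s : 'S_n) (s t \in large_live s t)%:R
    <= 3 / 4 * n`!%:R * ((t%:R + 1) * (15 / 16) ^+ t) :> R.
  have past s v : (t <= v)%N -> large_live (tperm t v * s)%g t = large_live s t.
    move=> tv; rewrite /large_live (@live_past _ s)// => u ut.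
    by rewrite permM tpermD// -val_eqE/= gtn_eqF// (leq_trans ut).
  have := card_perm_hit past.
  have -> : \sum_(s : 'S_n) (s t \in large_live s t)%:R =
     #|[set s : 'S_n | s t \in large_live s t]|%:R :> R.
    by rewrite -sum1_card natr_sum [RHS]big_mkcond/=; apply: eq_bigr => s _; rewrite inE; case: (_ \in _).
  set c := #|[set s : 'S_n | s t \in large_live s t]|.
  move=> E.
  have : ((n - t) * c)%:R <= \sum_(s : 'S_n) #|large_live s t|%:R :> R.
    rewrite E natr_sum; apply: ler_sum => s _; rewrite ler_nat.
    rewrite -[X in (X <= _)%N](card_imset _ (@perm_inj _ s)); apply: subset_leq_card.
    by apply/subsetP => _ /imsetP[v + ->]; rewrite inE => /andP[].
  have := ltn_ord t.
  move: (sum_large_live_le t).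
  set w := (15 / 16) ^+ t; have w0 : 0 <= w by rewrite exprn_ge0.
  set Z := \sum_(s : 'S_n) _ => HZ tn; rewrite natrM natrB ?(ltnW tn)// => H.
  have {HZ} H := le_trans H HZ.
  have GR : 2 * #|G|%:R <= n%:R :> R by rewrite -natrM ler_nat.
  have tR : t%:R + 1 <= n%:R :> R by rewrite natr1 ler_nat.
  have t0 : 0 <= t%:R :> R by [].
  have f0 : 0 <= n`!%:R :> R by [].
  have c0 : 0 <= c%:R :> R by [].
  have n0 : 0 < n%:R :> R by rewrite ltr0n.
  (* For [t < n], [n <= (t + 1) * (n - t)], which trades the factor [n - t] for the weight [t + 1];
     [2 * #|G| <= n] then turns [3 / 2] into [3 / 4]. *)
  rewrite -(ler_pM2l n0).
  apply: le_trans (_ : (t%:R + 1) * ((n%:R - t%:R) * c%:R) <= _).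
    rewrite mulrA ler_wpM2r//; nra.
  apply: le_trans (ler_wpM2l _ H) _; first by lra.
  have : 0 <= (t%:R + 1) * (w * n`!%:R) * (n%:R - 2 * #|G|%:R) :> R.
    by rewrite mulr_ge0 ?subr_ge0// mulr_ge0 ?mulr_ge0 ?addr_ge0.
  lra.
apply: le_trans (lerD (lexx _) (ler_sum _ (fun t _ => h2 t))) _.
rewrite -mulr_sumr.
have := sum_natr_geometric_le R n.
have f0 : 0 <= n`!%:R :> R by [].
move: (\sum_(t < n) _) => Z HZ; nra.
Qed.

End Live.

(** * From online policies to live goods *)

Section Policies.
Variables (R : realType) (n : nat).
Implicit Types (y : 'I_n -> R) (s : 'S_n) (t u : 'I_n) (a : policy R n).

Lemma history_eq y y' s s' t :
  (forall u, (u <= t)%N -> s u = s' u /\ y (s u) = y' (s u)) ->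
  history y s t = history y' s' t.
Proof.
move=> H; apply/eq_in_map => u; rewrite mem_filter => /andP[ut _].
by have [<- <-] := H u ut.
Qed.

Lemma mem_selected a y s t : (s t \in selected a y s) = a (history y s t).
Proof. by rewrite mem_imset ?inE//; exact: perm_inj. Qed.

Lemma sum_selected a y s :
  \sum_(i in selected a y s) y i = \sum_t (a (history y s t))%:R * y (s t).
Proof.
rewrite big_mkcond/= (reindex_inj (@perm_inj _ s))/=; apply: eq_bigr => t _.
by rewrite mem_selected; case: ifP; rewrite ?mul1r ?mul0r.
Qed.

Lemma mean_value_ge0 a y : (forall i, 0 <= y i) -> 0 <= mean_value a y.
Proof. by move=> y0; rewrite divr_ge0// sumr_ge0// => s _; rewrite sumr_ge0. Qed.

Lemma measurable_mean_value d (T : measurableType d) (A : T -> policy R n) y :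
  (forall h, measurable [set w | A w h]%classic) ->
  measurable_fun [set: T]%classic (fun w => mean_value (A w) y).
Proof.
move=> mA.
under eq_fun do rewrite /mean_value.
under eq_fun do under eq_bigr do rewrite sum_selected.
apply: measurable_funM => //; apply: measurable_sum => s; apply: measurable_sum => t.
apply: measurable_funM => //.
rewrite (_ : (fun w => _) = \1_([set w | A w (history y s t)]%classic)).
  exact: measurable_indic.
apply/funext => w; rewrite indicE; congr (nat_of_bool _)%:R.
by apply/idP/idP; rewrite inE.
Qed.

Definition unit_value (x : 'I_n) : 'I_n -> R := fun i => (i == x)%:R.

(** A run that collects [x] must end with [S x], the only set of the family containing [x]. Before
    [x] arrives only zeros are seen, so the decisions are those of the all-zero run, in which [x] is
    live on arrival. *)
Lemma sum_mean_value_le (G : {set 'I_n}) (S : 'I_n -> {set 'I_n}) a :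
  (0 < n)%N -> (2 * #|G| <= n)%N ->
  (forall x z, x \in G -> z \in G -> (z \in S x) = (z == x)) ->
  (forall x z, x \in G -> z \in G -> x != z ->
    (n <= 8 * #|separators (S x) (S z)|)%N) ->
  (forall x s, x \in G -> selected a (unit_value x) s \in [set S z | z in G]) ->
  \sum_(x in G) mean_value a (unit_value x) <= 193.
Proof.
move=> n0 G2 SG sep val.
pose decision s t := a (history (fun=> 0) s t).
have past s s' t : (forall u, (u <= t)%N -> s u = s' u) -> decision s t = decision s' t.
  by move=> H; congr a; apply: history_eq => u ut; rewrite H.
have fact0 : 0 < n`!%:R :> R by rewrite ltr0n fact_gt0.
rewrite -mulr_suml ler_pdivrMr// exchange_big/=.
apply: le_trans (sum_card_hit_le R past n0 G2 sep); apply: ler_sum => s _.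
have E x : \sum_(i in selected a (unit_value x) s) unit_value x i =
    (x \in selected a (unit_value x) s)%:R.
  rewrite big_mkcond/= (bigD1 x)//= big1 => [|i /negPf ix]; last first.
    by rewrite /unit_value ix; case: ifP.
  by rewrite addr0 /unit_value eqxx; case: ifP.
under eq_bigr do rewrite E.
rewrite -natr_sum ler_nat.
rewrite -(card_imset _ (@perm_inj _ s)) -sum1_card big_mkcond [leqRHS]big_mkcond/=.
apply: leq_sum => x _.
have [xG|//] := boolP (x \in G); have [xsel|//] := boolP (x \in selected _ _ _).
rewrite (_ : x \in _)//; apply/imsetP; exists (s^-1 x)%g; last by rewrite permKV.
rewrite inE permKV inE xG/=; apply/forallP => u; apply/implyP => ux.
have /imsetP[z zG selE] := val x s xG.
have zx : z = x by move: xsel; rewrite selE SG// => /eqP.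
rewrite -zx -selE mem_selected; apply/eqP; congr a; apply: history_eq => v vu.
split=> //; rewrite /unit_value; case: eqP => // sv.
by move: ux; rewrite -sv permK ltnNge vu.
Qed.

End Policies.

(** * Lower bound by averaging over the hidden good *)

Section LowerBound.
Variable R : realType.
Local Open Scope ereal_scope.

Lemma opt_unit_value n (F : feasible_family n) (x : 'I_n) (X : {set 'I_n}) :
  X \in F -> x \in X -> (1 <= opt F (unit_value R x))%R.
Proof.
move=> XF xX; rewrite /opt.
apply: le_trans (le_bigmax_cond _ _ XF) => /=.
rewrite (bigD1 x)//= /unit_value eqxx lerDl sumr_ge0//.
Qed.

(** The family is the same for all goods and the expected values add up to at most 193, so some good
    yields at most [193 / #|G|] against an optimum of at least 1; since [n <= 4 * #|G|], the
    constant is [772 = 4 * 193]. *)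
Lemma algorithm_ratio_ge n d (T : measurableType d) (P : probability T R)
    (A : algorithm R n T) : (2 <= n)%N -> valid_algorithm A ->
  (n%:R / 772)%:E <= algorithm_ratio P A.
Proof.
move=> n2 [mA valid].
have [G [S [G_le G_ge SG sep]]] := separated_family n2.
have n0 : (0 < n)%N by exact: leq_trans n2.
have G0 : (0 < #|G|)%N by lia.
pose F := [set S x | x in G].
have inst x : is_instance F (@unit_value R n x).
  split; last by move=> i; rewrite /unit_value.
  by have /card_gt0P[z zG] := G0; apply/set0Pn; exists (S z); apply: imset_f.
pose E x := expected_value P A F (unit_value R x).
have mE x : measurable_fun [set: T]%classic (fun w => mean_value (A w F) (unit_value R x)).
  by apply: measurable_mean_value => h; exact: mA.
have v0 x w : (0 <= mean_value (A w F) (unit_value R x))%R.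
  by apply: mean_value_ge0 => i; exact: (inst x).2.
have E0 x : 0 <= E x by exact: expectation_ge0.
have sumE : \sum_(x in G) E x <= 193%:E.
  rewrite /E /expected_value; under eq_bigr do rewrite expectation.unlock.
  rewrite -big_enum -ge0_integral_sum//=; first last.
  - by move=> x w _; rewrite lee_fin.
  - by move=> x; apply/measurable_EFinP.
  under eq_integral do rewrite sumEFin big_enum.
  rewrite -[leRHS](_ : \int[P]_(w in [set: T]%classic) cst 193%:E w = _); last first.
    by rewrite integral_cst//= -[X in _ * X]/(P _) probability_setT mule1.
  apply: ge0_le_integral => //.
  - by move=> w _; rewrite lee_fin sumr_ge0.
  - apply/measurable_EFinP.
    under eq_fun do rewrite -big_enum.
    exact: measurable_sum.
  - move=> w _; rewrite lee_fin; apply: (sum_mean_value_le (S := S)) => // x s xG.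
    exact: valid.
have [x xG Ex] : exists2 x, x \in G & E x <= (193 / #|G|%:R)%:E.
  apply: contrapT => H.
  have {}H x : x \in G -> (193 / #|G|%:R)%:E < E x.
    by move=> xG; rewrite ltNge; apply/negP => Ex; apply: H; exists x.
  move: sumE; apply/negP; rewrite -ltNge.
  have GR : (0 < #|G|%:R :> R)%R by rewrite ltr0n.
  have -> : 193%:E = \sum_(x in G) (193 / #|G|%:R)%:E :> \bar R.
    by rewrite sumEFin sumr_const -[X in _ = X%:E]mulr_natr divfK ?gt_eqF.
  have /card_gt0P[z zG] := G0.
  rewrite (bigD1 z)//= [ltRHS](bigD1 z)//=.
  rewrite lte_leD ?H//.
    by rewrite sumEFin.
  by apply: lee_sum => i /andP[iG _]; exact/ltW/H.
apply: (@le_trans _ _ ((opt F (unit_value R x))%:E / E x)); last first.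
  by apply: ereal_sup_ubound; exists F, (unit_value R x).
have GR : (0 < #|G|%:R :> R)%R by rewrite ltr0n.
have nG : (n%:R <= 4 * #|G|%:R :> R)%R by rewrite -natrM ler_nat.
apply: (@le_trans _ _ (#|G|%:R / 193)%:E); first by rewrite lee_fin; lra.
have o1 : 1 <= (opt F (unit_value R x))%:E.
  by rewrite lee_fin; apply: (opt_unit_value (X := S x)); rewrite ?imset_f// SG.
have inv : (#|G|%:R / 193)%:E <= (E x)^-1.
  rewrite inve_pge ?inE ?E0 ?lee_fin ?divr_ge0//.
  by rewrite inver mulf_eq0 invr_eq0 gt_eqF//= gt_eqF// invf_div.
apply: le_trans inv _.
by rewrite -[leLHS]mul1e lee_wpmul2r// inve_ge0.
Qed.

Lemma Omega_competitive_ratio_known : Omega_n_div_log_star (competitive_ratio_known R).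
Proof.
have c0 : (0 < 772^-1 :> R)%R by rewrite invr_gt0 ltr0n.
exists (772^-1)%R, 2%N; split; first exact: c0.
move=> n n2; apply: le_ereal_inf_tmp => _ [d [T [P [A [vA ->]]]]].
apply: le_trans (algorithm_ratio_ge P n2 vA); rewrite lee_fin.
rewrite mulrC (ler_wpM2r (ltW c0)) => [//|].
(* Division by [log_star] gives 0 if it is 0, and otherwise does not increase [n]. *)
case: (log_star _) => [|k]; first by rewrite invr0 mulr0.
by rewrite ler_pdivrMr ?ltr0n// ler_peMr// ler1n.
Qed.

(** An oracle algorithm is in particular one that knows the family. Lower bounds thus pass to the
    oracle model, upper bounds to the other one. *)
Lemma competitive_ratio_known_le_oracle n :
  competitive_ratio_known R n <= competitive_ratio_oracle R n.
Proof.
apply: ereal_inf_le_tmp => _ [d [T [P [B [vB ->]]]]].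
by exists d, T, P, (with_oracle B).
Qed.

End LowerBound.

(** * Greedy completion of an extendable set *)

Section Greedy.
Variable n : nat.
Implicit Types (X : {set 'I_n}) (l : seq 'I_n) (F : feasible_family n).

Fixpoint greedy_set (O : {set 'I_n} -> bool) X l : {set 'I_n} :=
  if l is j :: l' then greedy_set O (if O (j |: X) then j |: X else X) l' else X.

(** Continuation-passing style, since a program returns only a boolean: [k] turns the final set into
    a decision. *)
Fixpoint greedy_program X l (k : {set 'I_n} -> oracle_program n) : oracle_program n :=
  if l is j :: l' then
    Query (j |: X) (fun b => greedy_program (if b then j |: X else X) l' k)
  else k X.

Lemma run_greedy_program O X l k :
  run O (greedy_program X l k) = run O (k (greedy_set O X l)).
Proof. by elim: l X => //= j l IH X; rewrite IH. Qed.

Lemma sub_greedy_set O X l : X \subset greedy_set O X l.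
Proof.
elim: l X => //= j l IH X; apply: fintype.subset_trans (IH _).
by case: ifP => // _; exact: finset.subsetUr.
Qed.

Lemma extendable_sub F X (Y : {set 'I_n}) : X \subset Y -> extendable F Y -> extendable F X.
Proof.
move=> XY /existsP[Z /andP[ZF YZ]]; apply/existsP; exists Z.
by rewrite ZF (fintype.subset_trans XY).
Qed.

Lemma extendable_greedy_set F X l :
  extendable F X -> extendable F (greedy_set (extendable F) X l).
Proof. by elim: l X => //= j l IH X XF; apply: IH; case: ifP. Qed.

(** Subsets of extendable sets are extendable, so an item rejected during the scan cannot be added
    to the larger final set. *)
Lemma greedy_set_maximal F X l j : j \in l ->
  extendable F (j |: greedy_set (extendable F) X l) ->
  j \in greedy_set (extendable F) X l.
Proof.
elim: l X => //= i l IH X; rewrite inE => /orP[/eqP -> e|jl]; last exact: IH.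
move: e; case: ifP => [_ _|iX e].
  by apply: (fintype.subsetP (sub_greedy_set _ _ _)); rewrite !inE eqxx.
suff: extendable F (i |: X) by rewrite iX.
apply: extendable_sub _ e.
by rewrite finset.setUS// sub_greedy_set.
Qed.

(** The final set lies in some feasible [X]; each item of [X] could be added to it, so by maximality
    it equals [X]. *)
Lemma greedy_set_feasible F l : F != finset.set0 -> (forall j, j \in l) ->
  greedy_set (extendable F) finset.set0 l \in F.
Proof.
move=> /set0Pn[X0 X0F] jl.
have : extendable F (greedy_set (extendable F) finset.set0 l).
  apply: extendable_greedy_set; apply/existsP; exists X0.
  by rewrite X0F finset.sub0set.
set g := greedy_set _ _ _ => /existsP[X /andP[XF gX]].
suff -> : g = X by [].
apply/eqP; rewrite finset.eqEsubset gX; apply/fintype.subsetP => j jX.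
apply: greedy_set_maximal => //; apply/existsP; exists X.
by rewrite XF finset.subUset finset.sub1set jX.
Qed.

End Greedy.

(** * Upper bound: greedy completion of the first arrival *)

Section UpperBound.
Variable R : realType.

(* The first arriving item is uniformly random, so no random seed is needed. *)
Definition greedy_first n : oracle_algorithm R n unit := fun _ h =>
  if h is p :: h' then
    greedy_program finset.set0 (p.1 :: enum 'I_n)
      (fun X => Decide ((last p h').1 \in X))
  else Decide false.

(** It depends on [s] through the first arrival only, so every arrival recomputes the same set. *)
Definition first_greedy_set n (F : feasible_family n.+1) (s : 'S_n.+1) :=
  greedy_set (extendable F) finset.set0 (s ord0 :: enum 'I_n.+1).

Lemma selected_greedy_first n (F : feasible_family n.+1) (y : 'I_n.+1 -> R) s :
  selected (with_oracle (@greedy_first n.+1) tt F) y s = first_greedy_set F s.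
Proof.
apply/setP => i; rewrite -[i](permKV s); set t := (s^-1 i)%g.
rewrite mem_selected /with_oracle /greedy_first.
pose ts := [seq u : 'I_n.+1 <- enum 'I_n.+1 | (u <= t)%N].
(* Hence the history starts with the first arrival and ends with the current item. *)
have vts : map val ts = iota 0 t.+1.
  rewrite /ts -(filter_map val (fun u => (u <= t)%N)) val_enum_ord.
  exact: (filter_iota_leq 0 (ltn_ord t)).
have -> : history y s t = [seq (s u, y (s u)) | u <- ts] by [].
case: ts vts => [//|u ts] /= [u0 vts].
have -> : u = ord0 by apply: val_inj.
rewrite run_greedy_program/= (last_map (fun u => (s u, y (s u))))/=.
suff -> : last ord0 ts = t by [].
apply: val_inj; rewrite -[LHS](last_map val) vts. rewrite /=.
by move: (nat_of_ord t) => [|k] //; rewrite -(addn1 k) iotaD last_cat/= add1n addn1.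
Qed.

(** A transposition makes all times equidistributed, and summing over the times counts each item
    once per order. *)
Lemma sum_perm_first n (f : 'I_n.+1 -> R) :
  \sum_(s : 'S_n.+1) f (s ord0) = (n.+1)`!%:R / n.+1%:R * \sum_i f i.
Proof.
have E t : \sum_(s : 'S_n.+1) f (s t) = \sum_(s : 'S_n.+1) f (s ord0).
  rewrite (reindex_inj (mulgI (tperm t ord0))); apply: eq_bigr => s _.
  by rewrite permM tpermL.
have n0 : n.+1%:R != 0 :> R by rewrite pnatr_eq0.
apply: (mulfI n0); rewrite mulrA mulrCA divff// mulr1.
transitivity (\sum_(t < n.+1) \sum_(s : 'S_n.+1) f (s t)).
  by rewrite (eq_bigr _ (fun t _ => E t)) sumr_const card_ord mulr_natl.
rewrite exchange_big/= (eq_bigr (fun=> \sum_i f i)) => [|s _].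
  by rewrite sumr_const card_Sn mulr_natl.
by rewrite [RHS](reindex_inj (@perm_inj _ s)).
Qed.

Lemma opt_le_greedy_first n (F : feasible_family n) (y : 'I_n -> R) :
  is_instance F y ->
  opt F y <= n%:R * mean_value (with_oracle (@greedy_first n) tt F) y.
Proof.
move=> [F0 y0]; case: n => [|n] in F y F0 y0 *.
  rewrite mul0r /opt; apply: bigmax_le => // X _; rewrite big1// => -[].
  by [].
rewrite /mean_value mulrCA.
have n0 : 0 < n.+1%:R :> R by rewrite ltr0n.
have f0 : 0 < (n.+1)`!%:R :> R by rewrite ltr0n fact_gt0.
(* The sum of [f] dominates [opt], while the first arrival alone secures [f (s ord0)]. *)
pose f i := (extendable F [set i])%:R * y i.
have le1 : \sum_i f i <=
    n.+1%:R / (n.+1)`!%:R * \sum_(s : 'S_n.+1) \sum_(i in first_greedy_set F s) y i.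
  rewrite mulrC -ler_pdivrMr ?divr_gt0// invf_div mulrC -sum_perm_first.
  apply: ler_sum => s _; rewrite /f.
  case: (boolP (extendable _ _)) => ext; last by rewrite mul0r sumr_ge0.
  rewrite mul1r (bigD1 (s ord0))/= ?lerDl ?sumr_ge0//.
  rewrite /first_greedy_set/= finset.setU0 ext.
  by apply: (fintype.subsetP (sub_greedy_set _ _ _)); rewrite inE.
apply: le_trans (_ : _ <= \sum_i f i) _.
  apply: bigmax_le => [|X XF]; first by rewrite sumr_ge0// => i _; rewrite mulr_ge0.
  rewrite big_mkcond/=; apply: ler_sum => i _; case: ifP => iX; last by rewrite mulr_ge0.
  rewrite /f (_ : extendable F _) ?mul1r//.
  by apply/existsP; exists X; rewrite XF finset.sub1set.
apply: le_trans le1 _; rewrite mulrC ler_wpM2r ?divr_ge0//.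
by apply: ler_sum => s _; rewrite selected_greedy_first.
Qed.

Local Open Scope ereal_scope.

Lemma competitive_ratio_oracle_le n : competitive_ratio_oracle R n <= n%:R%:E.
Proof.
pose P := \d_tt : probability unit R.
pose A := with_oracle (@greedy_first n).
have valid : valid_algorithm A.
  split=> // -[] F y s [F0 y0].
  case: n => [|n] in F y s F0 y0 A P *.
    have /set0Pn[X XF] := F0; rewrite (_ : selected _ _ _ = X)//.
    by apply/setP => -[].
  rewrite selected_greedy_first; apply: greedy_set_feasible => // j.
  by rewrite inE mem_enum orbT.
apply: (@le_trans _ _ (algorithm_ratio P A)).
  by apply: ereal_inf_lbound; exists _, _, P, (@greedy_first n).
apply: ge_ereal_sup => _ [F [y [inst ->]]].
have -> : expected_value P A F y = (mean_value (A tt F) y)%:E.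
  rewrite -(expectation_cst P) /expected_value.
  by congr (expectation P _); apply/funext => -[].
have := opt_le_greedy_first inst; rewrite -/A.
have : (0 <= mean_value (A tt F) y)%R by exact: mean_value_ge0 inst.2.
(* A zero mean value forces [opt] to be 0, and the ratio is then [0 * +oo = 0]. *)
rewrite le0r => /orP[/eqP -> | m0 le].
  rewrite mulr0 => opt0; rewrite (_ : opt F y = 0%R) ?mul0e ?lee_fin//.
  by apply/eqP; rewrite eq_le opt0 bigmax_ge_id.
by rewrite inver gt_eqF// -EFinM lee_fin ler_pdivrMr.
Qed.

End UpperBound.

Theorem theorem4p2 (R : realType) :
  ((forall n : nat, (competitive_ratio_known R n <= n%:R%:E)%E) /\
   Omega_n_div_log_star (competitive_ratio_known R)) /\
  ((forall n : nat, (competitive_ratio_oracle R n <= n%:R%:E)%E) /\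
   Omega_n_div_log_star (competitive_ratio_oracle R)).
Proof.
have known_le n := competitive_ratio_known_le_oracle R n.
have Omega_known := Omega_competitive_ratio_known R.
split; split.
- move=> n; exact: le_trans (known_le n) (competitive_ratio_oracle_le R n).
- exact: Omega_known.
- exact: competitive_ratio_oracle_le.
- have [c [n0 [c0 H]]] := Omega_known; exists c, n0; split=> // n n0n.
  exact: le_trans (H n n0n) (known_le n).
Qed.
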